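(* In the $k$-tier uplink model described in the context, the average energy efficiency of UE associated with the $i$-th tier BS, in the decoupled (DUDA) and in the coupled (CUDA) network, is given by $$EE^i=\frac{\displaystyle\sum_{u\in\Phi_U,\ u\text{ associated with the }i\text{-th tier BS}}R_{u,i}}{\displaystyle\sum_{v\in\Phi_U,\ v\text{ associated with the }i\text{-th tier BS}}P_{v,i}}=\frac{R_iN_i}{\mathbb E[P_{v,i}]\,N_i}=\frac{R_i}{\mathbb E[P_{v,i}]},$$ and the energy efficiency of the whole network, in DUDA and in CUDA, is given by $$EE=\frac{\sum_{i\in K}R_i\cdot N_i}{\sum_{j\in K}\mathbb E[P_{v,j}]\cdot N_j}.$$ Here $R_{u,i}$ and $P_{v,i}$ are the uplink rate and the transmit power of a UE associated with the $i$-th tier, $R_i$ is the spatial average rate of UE associated with the $i$-th tier, $\mathbb E[P_{v,i}]$ is the average transmit power of UE associated with the $i$-th tier, and $N_i$ is the number of UE associated with the $i$-th tier, all taken in the mode considered.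
   Context: A heterogeneous cellular network has tiers $K=\{1,\dots,k\}$. The base stations (BSs) of tier $i$ form an independent homogeneous Poisson point process in the plane of intensity $\lambda_{B_i}$, with transmit power $P_{B_i}$ and path loss exponent $\alpha_i>2$ (path loss $\|x\|^{-\alpha_i}$). User equipment (UE) locations form a different independent stationary point process $\Phi_U$ of intensity $\lambda_U$. Rayleigh fading gains $h$ are i.i.d. $\mathrm{Exp}(1)$. All BSs are open access and share the same total bandwidth $W$, which is equally allocated among UE. Put $\lambda_{BH}=\sum_{i\in K}\lambda_{B_i}$. Modes. In DUDA a UE is connected in the uplink to the geographically closest BS. In CUDA a UE is associated, in uplink and downlink, with the BS giving the strongest received (downlink) power. The distance $\rho_i$ from a UE to its associated BS of tier $i$ has density $2\pi\lambda_{BH}r e^{-\lambda_{BH}\pi r^2}$ in DUDA and $2\pi\lambda_{B_i}re^{-\lambda_{B_i}\pi r^2}$ in CUDA. Association probabilities. $A_i$ is the probability that a UE is associated with a tier-$i$ BS. Its value in the model is $\lambda_{B_i}/\sum_{j\in K}\lambda_{B_j}$ in DUDA; in CUDA it is, when fading is considered, $$\pi\lambda_{B_i}\int_0^\infty\!\!\int_0^\infty \frac{1}{(1+z)^2}\exp\Big(-\pi\sum_{j\ne i}\lambda_{B_j}\big(\tfrac{P_{B_j}}{P_{B_i}}\big)^{2/\alpha_j}z^{2/\alpha_j}v^{\alpha_i/\alpha_j}-\lambda_{B_i}\pi v\Big)dv\,dz,$$ or, when it is not, $$\pi\lambda_{B_i}\int_0^\infty \exp\Big(-\pi\sum_{j\ne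 i}\lambda_{B_j}\big(\tfrac{P_{B_j}}{P_{B_i}}\big)^{2/\alpha_j}r^{\alpha_i/\alpha_j}-\lambda_{B_i}\pi r\Big)dr.$$ The number of UE associated with tier $i$ is $N_i=A_i\lambda_U$, and with one BS of tier $i$ it is $n_i=A_i\lambda_U/\lambda_{B_i}$. Power control. UE power consumption is a static part plus a transmit power (having an upper bound $P_{U_T,\max}$); only the transmit power enters the energy efficiency. A UE at distance $\|x\|$ from its associated tier-$i$ BS has transmit power $P_{U,\varepsilon_i}\|x\|^{\alpha_i\varepsilon_i}$, where $\varepsilon_i\in[0,1]$ is the fractional power control factor and $P_{U,\varepsilon_i}$ is a constant baseline power. The average transmit power of UE associated with tier $i$ is $\mathbb E[P_{v,i}]=\mathbb E[P_{U,\varepsilon_i}\rho_i^{\alpha_i\varepsilon_i}]$. SINR and rate. A randomly chosen BS (of tier $i$) is placed at the origin. The distance $D$ between any UE and this BS has density $f_D(d)=2\pi\lambda_Ud\,e^{-\lambda_U\pi d^2}$. With the associated UE $u$ at distance $D_u$ with fading $h_u$, noise power $\sigma^2$, and a set $\Phi_I$ of interfering UE, $$\mathrm{SINR}_i=\frac{P_{U,\varepsilon_i}h_u\|D_u\|^{\alpha_i(\varepsilon_i-1)}}{I+\sigma^2},\qquad I=\sum_{v\in\Phi_I}P_{v,\varepsilon_v}h_v\|\rho_v\|^{\alpha_v\varepsilon_v}\|D_v\|^{-\alpha_v},$$ where, for each interferer $v$, $\rho_v$ is its distance to its own associated BS, $D_v$ its distance to the BS at the origin, $h_v$ its fading, and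 $P_{v,\varepsilon_v},\alpha_v,\varepsilon_v$ its baseline power, path loss exponent and power control factor (those of the tier it is associated with). The spatial average rate of UE associated with tier $i$ is $R_i=\mathbb E\big[\frac{W}{n_i}\ln(1+\mathrm{SINR}_i)\big]$. Energy efficiency is defined as $EE=\sum_{u\in\Phi_U}R_u\big/\sum_{v\in\Phi_U}P_v$, where $R_u$ is the rate of the uplink transmission of UE $u$ received by the BSs and $P_v$ is the transmit power of UE $v$.
   Formalization: Sums over all of Φ_U are infinite, so EE^i and EE are taken as ratios of expected sums over UE in any Borel window of finite positive area; R_i, E[P_{v,i}] and A_i are the model's true typical-UE averages, not computed from the stated (mutually inconsistent) densities and integrals. *)

(* Defs.v *)
From HB Require Import structures.
From mathcomp Require Import all_boot all_order all_algebra.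
From mathcomp Require Import all_classical all_reals all_analysis.

Set Implicit Arguments.
Unset Strict Implicit.
Unset Printing Implicit Defensive.
Import Order.TTheory GRing.Theory Num.Theory.
Import numFieldNormedType.Exports.
Local Open Scope classical_set_scope.
Local Open Scope ring_scope.

Notation plane R := (measurableTypeR R * measurableTypeR R)%type.

Definition area (R : realType) (B : set (plane R)) : \bar R :=
  (@lebesgue_measure R \x @lebesgue_measure R)%E B.

(* Euclidean; the library's norm on a product is the sup norm. *)
Definition eudist (R : realType) (x y : plane R) : R :=
  Num.sqrt ((x.1 - y.1) ^+ 2 + (x.2 - y.2) ^+ 2).

Section PointProcesses.
Context {R : realType} {d : measure_display} {Omega : measurableType d}.
Variable P : probability Omega R.

(* A simple, locally finite point process in the plane, given by a measurable
   enumeration: the [n]-th point exists on the event [pp_on n]; where it does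
   not exist, the value of [pp_loc n] is irrelevant. *)
Record pointProcess := PointProcess {
  pp_on : nat -> set Omega;
  pp_loc : nat -> Omega -> plane R;
  pp_on_measurable : forall n, measurable (pp_on n);
  pp_loc_measurable : forall n, measurable_fun [set: Omega] (pp_loc n);
  pp_simple : forall w m n, pp_on m w -> pp_on n w ->
    pp_loc m w = pp_loc n w -> m = n;
  pp_locally_finite : forall w r,
    finite_set [set n | pp_on n w /\ eudist 0 (pp_loc n w) <= r] }.

Definition points (X : pointProcess) (w : Omega) : set (plane R) :=
  [set x | exists2 n, pp_on X n w & x = pp_loc X n w].

Definition count (X : pointProcess) (B : set (plane R)) (w : Omega) : \bar R :=
  counting (points X w `&` B).

Definition has_intensity (X : pointProcess) (lam : R) : Prop :=
  forall B, measurable B -> (\int[P]_w count X B w = lam%:E * area B)%E.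

(* Mutual independence of the classes of events [F i]: the product rule for
   finitely many distinct indices. *)
Definition mutually_independent (I : Type) (F : I -> set (set Omega)) : Prop :=
  forall (n : nat) (s : 'I_n -> I) (E : 'I_n -> set Omega),
    injective s -> (forall j, F (s j) (E j)) ->
    P (\bigcap_(j in [set: 'I_n]) E j) = (\prod_(j < n) fine (P (E j)))%:E.

Definition count_events (X : pointProcess) (B : set (plane R)) : set (set Omega) :=
  [set [set w | count X B w = m%:R%:E] | m in [set: nat]].

Definition sigma_pp (X : pointProcess) : set (set Omega) :=
  <<s \bigcup_(B in measurable) count_events X B >>.

Definition sigma_rv (X : Omega -> R) : set (set Omega) :=
  [set X @^-1` C | C in measurable].

Definition is_PPP (X : pointProcess) (lam : R) : Prop :=
  (forall B, measurable B -> (area B < +oo)%E -> forall m : nat,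
     let mean := lam * fine (area B) in
     P [set w | count X B w = m%:R%:E] = (expR (- mean) * mean ^+ m / m`!%:R)%:E)
  /\
  (forall (n : nat) (B : 'I_n -> set (plane R)),
     (forall j, measurable (B j)) -> trivIset [set: 'I_n] B ->
     mutually_independent (fun j => count_events X (B j))).

End PointProcesses.
Arguments pointProcess R {d} Omega.

Record cellParams (R : realType) (k : nat) := CellParams {
  lamB : 'I_k -> R;       (* BS intensities *)
  PB : 'I_k -> R;         (* BS transmit powers *)
  alpha : 'I_k -> R;      (* path loss exponents *)
  lamU : R;               (* UE intensity *)
  W : R;                  (* bandwidth *)
  sigma2 : R;             (* noise power *)
  eps : 'I_k -> R;        (* fractional power control factors *)
  PU : 'I_k -> R;         (* UE baseline powers *)
  lamB_gt0 : forall i, 0 < lamB i;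
  PB_gt0 : forall i, 0 < PB i;
  alpha_gt2 : forall i, 2 < alpha i;
  lamU_gt0 : 0 < lamU;
  W_gt0 : 0 < W;
  sigma2_gt0 : 0 < sigma2;
  eps_itv : forall i, 0 <= eps i <= 1;
  PU_gt0 : forall i, 0 < PU i }.

(* [CUDA fading]: the flag tells whether the received downlink power that
   decides the association includes the fading gain. *)
Inductive mode := DUDA | CUDA (fading : bool).

Inductive link := uplink | downlink.

Section Network.
Context {R : realType} {d : measure_display} {Omega : measurableType d}.
Variables (k : nat) (Q : cellParams R k) (P : probability Omega R).

(* A base station: its tier and its position. *)
Definition station : Type := ('I_k * plane R)%type.

(* [shift t w] is the realization [w] seen from the point [t] of the plane.
   UE are designated by their positions. [gain l w u s] is the fading gain
   between UE [u] and BS [s] in direction [l]; [gain_rv l n i m] is the same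
   gain for the [n]-th UE and the [m]-th BS of tier [i] (see [gain_rvE] below).
   [serving w u] is the BS with which [u] is associated and [interferers w u]
   is the set of the UE interfering with the transmission of [u] to that BS. *)
Record network := Network {
  shift : plane R -> Omega -> Omega;
  UE : pointProcess R Omega;
  BS : 'I_k -> pointProcess R Omega;
  gain : link -> Omega -> plane R -> station -> R;
  gain_rv : link -> nat -> 'I_k -> nat -> Omega -> R;
  serving : Omega -> plane R -> station;
  interferers : Omega -> plane R -> set (plane R) }.

Variable N : network.
Implicit Types (w : Omega) (t u v : plane R) (s : station) (i : 'I_k).

Definition stations w : set station := [set s | points (BS N s.1) w s.2].

Definition received (fading : bool) w u s : R :=
  PB Q s.1 * (if fading then gain N downlink w u s else 1)
  * eudist u s.2 `^ (- alpha Q s.1).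

Definition association_rule (md : mode) w u : Prop :=
  match md with
  | DUDA => forall s, stations w s -> eudist u (serving N w u).2 <= eudist u s.2
  | CUDA fading => forall s, stations w s ->
      received fading w u s <= received fading w u (serving N w u)
  end.

Inductive source := SrcUE | SrcBS of 'I_k | SrcGain of link & nat & 'I_k & nat.

Definition source_events (x : source) : set (set Omega) :=
  match x with
  | SrcUE => sigma_pp (UE N)
  | SrcBS i => sigma_pp (BS N i)
  | SrcGain l n i m => sigma_rv (gain_rv N l n i m)
  end.

Definition shift_station t s : station := (s.1, s.2 - t).

Record is_network (md : mode) : Prop := IsNetwork {
  (* Stationarity: [shift] is a measure-preserving action of the plane with
     which the point processes and everything attached to them commute. *)
  shift0 : forall w, shift N 0 w = w;
  shiftD : forall t t' w, shift N (t + t') w = shift N t (shift N t' w);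
  shift_measurable : forall t, measurable_fun [set: Omega] (shift N t);
  shift_preserving : forall t A, measurable A -> P (shift N t @^-1` A) = P A;
  UE_shift : forall t w u, points (UE N) (shift N t w) (u - t) <-> points (UE N) w u;
  BS_shift : forall i t w b,
    points (BS N i) (shift N t w) (b - t) <-> points (BS N i) w b;
  gain_shift : forall l t w u s, points (UE N) w u -> stations w s ->
    gain N l (shift N t w) (u - t) (shift_station t s) = gain N l w u s;
  serving_shift : forall t w u, points (UE N) w u ->
    serving N (shift N t w) (u - t) = shift_station t (serving N w u);
  interferers_shift : forall t w u v, points (UE N) w u ->
    interferers N (shift N t w) (u - t) (v - t) <-> interferers N w u v;
  (* Laws of the point processes and of the fading. *)
  UE_intensity : has_intensity P (UE N) (lamU Q);
  BS_PPP : forall i, is_PPP P (BS N i) (lamB Q i);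
  gain_ge0 : forall l w u s, 0 <= gain N l w u s;
  gain_rvE : forall l n i m w, pp_on (UE N) n w -> pp_on (BS N i) m w ->
    gain N l w (pp_loc (UE N) n w) (i, pp_loc (BS N i) m w) = gain_rv N l n i m w;
  gain_rv_measurable : forall l n i m, measurable_fun [set: Omega] (gain_rv N l n i m);
  gain_rv_exp : forall l n i m (C : set R), measurable C ->
    P (gain_rv N l n i m @^-1` C) = exponential_prob 1 C;
  sources_independent : mutually_independent P source_events;
  (* Association and interference. *)
  serving_station : forall w u, points (UE N) w u -> stations w (serving N w u);
  serving_rule : {ae P, forall w, forall u, points (UE N) w u -> association_rule md w u};
  serving_measurable : forall n i m, measurable [set w |
    [/\ pp_on (UE N) n w, pp_on (BS N i) m w &
        serving N w (pp_loc (UE N) n w) = (i, pp_loc (BS N i) m w)]];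
  interferers_UE : forall w u v, points (UE N) w u -> interferers N w u v ->
    points (UE N) w v /\ v <> u;
  interferers_measurable : forall n m, measurable [set w |
    [/\ pp_on (UE N) n w, pp_on (UE N) m w &
        interferers N w (pp_loc (UE N) n w) (pp_loc (UE N) m w)]] }.

Definition tier w u : 'I_k := (serving N w u).1.

Definition rho w u : R := eudist u (serving N w u).2.

Definition txpower w u : R :=
  PU Q (tier w u) * rho w u `^ (alpha Q (tier w u) * eps Q (tier w u)).

(* Interference at the BS serving [u]; seen from that BS, [rho w u] and
   [eudist v (serving N w u).2] are the distances of [u] and [v] to the origin. *)
Definition interference w u : \bar R :=
  (\esum_(v in interferers N w u)
    (txpower w v * gain N uplink w v (serving N w u)
     * eudist v (serving N w u).2 `^ (- alpha Q (tier w v)))%:E)%E.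

(* [fine] maps [+oo] to [0] and [0^-1 = 0]: infinite interference gives SINR 0. *)
Definition SINR w u : R :=
  PU Q (tier w u) * gain N uplink w u (serving N w u)
  * rho w u `^ (alpha Q (tier w u) * (eps Q (tier w u) - 1))
  / fine (interference w u + (sigma2 Q)%:E)%E.

(* Expectation of [F] under the Palm probability of the UE process: [F] is
   evaluated for a typical UE, which sits at the origin. The association
   probabilities and the laws of the distances below are those induced by the
   point processes and the association rule; no closed form is assumed. *)
Definition palmE (F : Omega -> \bar R) : \bar R :=
  ((\int[P]_w \esum_(u in points (UE N) w `&` (`[0%R, 1%R[ `*` `[0%R, 1%R[)) F (shift N u w))
   / (lamU Q)%:E)%E.

Definition assoc_prob (i : 'I_k) : R :=
  fine (palmE (fun w => if tier w 0%R == i then 1%E else 0%E)).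

(* Palm expectation conditional on association with tier [i]. *)
Definition tierE (i : 'I_k) (f : Omega -> R) : \bar R :=
  (palmE (fun w => if tier w 0%R == i then (f w)%:E else 0%E) / (assoc_prob i)%:E)%E.

(* Mean number, per unit area, of the UE associated with tier [i]. *)
Definition NUE (i : 'I_k) : R := assoc_prob i * lamU Q.

Definition nUE (i : 'I_k) : R := assoc_prob i * lamU Q / lamB Q i.

Definition rate w u : R := W Q / nUE (tier w u) * ln (1 + SINR w u).

Definition Rbar (i : 'I_k) : \bar R :=
  tierE i (fun w => W Q / nUE i * ln (1 + SINR w 0)).

Definition EP (i : 'I_k) : \bar R :=
  tierE i (fun w => PU Q i * rho w 0 `^ (alpha Q i * eps Q i)).

(* The sums over all UE of the plane are infinite; they are taken as mean sums
   over the UE lying in a window [B]. *)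
Definition EE_tier (i : 'I_k) (B : set (plane R)) : \bar R :=
  ((\int[P]_w \esum_(u in points (UE N) w `&` B `&` [set u | tier w u = i]) (rate w u)%:E)
   / (\int[P]_w \esum_(v in points (UE N) w `&` B `&` [set v | tier w v = i]) (txpower w v)%:E))%E.

Definition EE (B : set (plane R)) : \bar R :=
  ((\int[P]_w \esum_(u in points (UE N) w `&` B) (rate w u)%:E)
   / (\int[P]_w \esum_(v in points (UE N) w `&` B) (txpower w v)%:E))%E.

End Network.

(* Main.v *)
(* Every average in the theorem is a mean sum over the UE in a window of the
   plane, of a nonnegative mark that is covariant under the stationary flow.
   By Campbell's formula such a mean sum over a window B is area(B) times the
   one over the unit square, which is lamU times a Palm expectation; this holds
   in [0, +oo], so no integrability of rates or powers is needed. The area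
   cancels in the energy efficiencies, and splitting the UE according to their
   tiers gives the sums over the tiers. *)
From HB Require Import structures.
Require Import Defs.
From mathcomp Require Import all_boot all_order all_algebra.
From mathcomp Require Import all_classical all_reals all_analysis.
From mathcomp Require Import measurable_realfun.
Import Order.TTheory GRing.Theory Num.Theory.
Import numFieldNormedType.Exports.
Local Open Scope classical_set_scope.
Local Open Scope ring_scope.

Set Implicit Arguments.
Unset Strict Implicit.
Unset Printing Implicit Defensive.

(** * Translation invariance of the area, and measurable maps of the plane *)

Section Plane.
Variable R : realType.
Local Notation T := (measurableTypeR R).
Local Notation lambda := (@lebesgue_measure R).

(** Lebesgue measure is determined by its values on the intervals []a, b]], and a translation keeps
    their lengths. *)
Lemma lebesgue_preimageD (x : R) (A : set T) : measurable A ->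
  lambda [set t | A (x + t)] = lambda A.
Proof.
move=> mA; rewrite -[LHS]/(pushforward lambda (fun t : T => (x + t : R) : T) A).
apply/esym/lebesgue_measure_unique => //.
  by apply: measurable_funD.
move=> mf _ [[a b]] _ <-; rewrite /= /pushforward.
have -> : (fun t : T => (x + t : R) : T) @^-1` `]a, b] = `](a - x), (b - x)]%classic.
  by apply/seteqP; split => t /=; rewrite !in_itv/= ltrBlDl lerBrDl.
rewrite !lebesgue_measure_itv/= !lte_fin ltrD2r -!EFinB.
by case: ifP => // _; rewrite opprB addrA subrK.
Qed.

Lemma lebesgue_preimageB (x : R) (A : set T) : measurable A ->
  lambda [set t | A (x - t)] = lambda A.
Proof.
move=> mA; rewrite -(lebesgue_preimageD x mA).
rewrite -[RHS]lebesgue_measureN//.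
have mf : measurable_fun setT (fun t : T => (x + t : R) : T) by apply: measurable_funD.
by have := mf measurableT _ mA; rewrite setTI.
Qed.

(** The pushforward of the area under the product map agrees with it on measurable rectangles, and a
    product measure is determined by these. *)
Lemma area_prod_preimage (f g : T -> T) :
  measurable_fun setT f -> measurable_fun setT g ->
  (forall A, measurable A -> lambda (f @^-1` A) = lambda A) ->
  (forall A, measurable A -> lambda (g @^-1` A) = lambda A) ->
  forall B : set (plane R), measurable B ->
    area [set t : plane R | B (f t.1, g t.2)] = area B.
Proof.
move=> mf mg fl gl B mB.
pose h (t : plane R) : plane R := (f t.1, g t.2).
have mh : measurable_fun setT h.
  by apply: measurable_fun_pair; exact: measurableT_comp.
rewrite -[LHS]/(pushforward (lambda \x lambda)%E h B).
apply/esym/product_measure_unique => // A1 A2 mA1 mA2.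
rewrite /= /pushforward -(fl _ mA1) -(gl _ mA2).
by rewrite -product_measure1E//; rewrite -[X in measurable X]setTI; [exact: mf|exact: mg].
Qed.

Lemma area_preimageD (u : plane R) (B : set (plane R)) : measurable B ->
  area [set t | B (u + t)] = area B.
Proof.
move=> mB; rewrite -[RHS](@area_prod_preimage
    (fun t : T => (u.1 + t : R)) (fun t : T => (u.2 + t : R)))//.
- by apply: measurable_funD.
- by apply: measurable_funD.
- exact: lebesgue_preimageD.
- exact: lebesgue_preimageD.
Qed.

Lemma area_preimageB (u : plane R) (B : set (plane R)) : measurable B ->
  area [set t | B (u - t)] = area B.
Proof.
move=> mB; rewrite -[RHS](@area_prod_preimage
    (fun t : T => (u.1 - t : R)) (fun t : T => (u.2 - t : R)))//.
- by apply: measurable_funB.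
- by apply: measurable_funB.
- exact: lebesgue_preimageB.
- exact: lebesgue_preimageB.
Qed.

(** The same window as in the definition of [palmE]. *)
Definition unit_square : set (plane R) := `[0%R, 1%R[ `*` `[0%R, 1%R[.

Lemma measurable_unit_square : measurable unit_square.
Proof. exact: measurableX. Qed.

Lemma area_unit_square : area unit_square = 1%E.
Proof.
rewrite /area [LHS]product_measure1E//= !lebesgue_measure_itv/=.
by rewrite lte_fin ltr01 sube0 mule1.
Qed.

(* Needed because the inferred sigma-finite structure of [lambda \x lambda] is
   the one of products of subprobabilities, which does not apply. *)
Lemma sigma_finite_area : sigma_finite [set: plane R] (@area R).
Proof.
exists (fun n => `]- n%:R, n%:R[ `*` `]- n%:R, n%:R[) => [|n].
  apply/esym/seteqP; split => // -[x y] _.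
  exists (Num.bound (`|x| + `|y|)) => //=.
  have xy : `|x| + `|y| < (Num.bound (`|x| + `|y|))%:R.
    exact: archi_boundP (addr_ge0 _ _).
  rewrite !in_itv/= -!ltr_norml; split.
    by apply: le_lt_trans xy; rewrite lerDl.
  by apply: le_lt_trans xy; rewrite lerDr.
split; first exact: measurableX.
rewrite /area [ltLHS]product_measure1E// lte_mul_pinfty ?ge0_fin_numE//=;
  by rewrite lebesgue_measure_itv; case: ifP; rewrite -?EFinB ltry.
Qed.

HB.instance Definition _ :=
  Measure.copy (@area R) (lambda \x lambda)%E.
HB.instance Definition _ :=
  Measure_isSigmaFinite.Build _ (plane R) R (@area R) sigma_finite_area.

Section MeasurablePlane.
Context {d} {S : measurableType d}.
Implicit Types f g : S -> plane R.

Lemma measurable_planeD f g : measurable_fun setT f -> measurable_fun setT g ->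
  measurable_fun setT (fun s => f s + g s : plane R).
Proof.
move=> /measurable_fun_pairP[f1 f2] /measurable_fun_pairP[g1 g2].
by apply: measurable_fun_pair; [exact: (measurable_funD f1 g1)|exact: (measurable_funD f2 g2)].
Qed.

Lemma measurable_planeB f g : measurable_fun setT f -> measurable_fun setT g ->
  measurable_fun setT (fun s => f s - g s : plane R).
Proof.
move=> /measurable_fun_pairP[f1 f2] /measurable_fun_pairP[g1 g2].
by apply: measurable_fun_pair; [exact: (measurable_funB f1 g1)|exact: (measurable_funB f2 g2)].
Qed.

Lemma measurable_eudist f g : measurable_fun setT f -> measurable_fun setT g ->
  measurable_fun setT (fun s => eudist (f s) (g s)).
Proof.
move=> /measurable_fun_pairP[f1 f2] /measurable_fun_pairP[g1 g2].
apply: (@measurableT_comp _ _ _ _ _ _ (@Num.sqrt R)).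
  by apply: continuous_measurable_fun; exact: sqrt_continuous.
by apply: measurable_funD; apply: measurable_funX; exact: measurable_funB.
Qed.

End MeasurablePlane.

Lemma eudistB (x y t : plane R) : eudist (x - t) (y - t) = eudist x y.
Proof.
have subB (a b c : R) : a - c - (b - c) = a - b by rewrite opprB addrA subrK.
by rewrite /eudist !subB.
Qed.

End Plane.

Arguments unit_square {R}.

(** * Sums of marks over the points of a process *)

Section MarkedPointProcess.
Context {R : realType} {d : measure_display} {Omega : measurableType d}.
Variables (P : probability Omega R) (X : pointProcess R Omega).
Implicit Types (f : Omega -> plane R -> \bar R) (B : set (plane R)).
Local Open Scope ereal_scope.

(** Restricted by 0 because [pp_loc X n] carries no information where the [n]-th point does not
    exist. *)
Definition mark f n : Omega -> \bar R :=
  (fun w => f w (pp_loc X n w)) \_ (pp_on X n).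

(** Measurability is asked along each enumerated point only, not jointly in the realization and the
    position. *)
Definition measurable_mark f :=
  forall n, measurable_fun (pp_on X n) (fun w => f w (pp_loc X n w)).

Definition mark_ge0 f := forall w u, points X w u -> 0 <= f w u.

Lemma mark_ge0P f n w : mark_ge0 f -> 0 <= mark f n w.
Proof.
move=> f0; rewrite /mark patchE; case: ifPn => // /set_mem on_n.
by apply: f0; exists n.
Qed.

Lemma measurable_markT f n : measurable_mark f -> measurable_fun setT (mark f n).
Proof.
move=> mf; apply/measurable_restrict => //; first exact: pp_on_measurable.
by rewrite setTI.
Qed.

(** The process is simple, so the enumeration is injective where points exist and the sum over a
    random set becomes a series over a fixed index set. *)
Lemma esum_points f B w : mark_ge0 f ->
  \esum_(u in points X w `&` B) f w u
  = \sum_(n <oo) mark f n w * (\1_B (pp_loc X n w))%:E.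
Proof.
move=> f0.
have -> : points X w `&` B =
    pp_loc X ^~ w @` [set n | pp_on X n w /\ B (pp_loc X n w)].
  apply/seteqP; split => [_ [[n on_n ->] Bn]|_ [n [on_n Bn] <-]]; first by exists n.
  by split => //; exists n.
rewrite esum_image; last first.
  by move=> m n /set_mem/= [on_m _] /set_mem/= [on_n _]; exact: pp_simple.
rewrite nneseries_esumT; last by move=> n; rewrite mule_ge0 ?mark_ge0P ?lee_fin.
rewrite esum_mkcond; apply: eq_esum => n _.
rewrite /mark patchE indicE.
have [on_n|off_n] := pselect (pp_on X n w); last first.
  rewrite (memNset off_n) mul0e memNset// => -[on_n _]; exact: off_n.
rewrite (mem_set on_n); have [Bn|Bn] := pselect (B (pp_loc X n w)).
  by rewrite !mem_set// mule1.
by rewrite (memNset Bn) mule0 memNset// => -[_].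
Qed.

Lemma measurable_esum_points f B : measurable B -> mark_ge0 f -> measurable_mark f ->
  measurable_fun setT (fun w => \esum_(u in points X w `&` B) f w u).
Proof.
move=> mB f0 mf; under eq_fun do rewrite esum_points//.
apply: ge0_emeasurable_sum => // [n w _ _|n _].
  by rewrite mule_ge0 ?mark_ge0P ?lee_fin.
apply: emeasurable_funM; first exact: measurable_markT.
apply/measurable_EFinP; apply: measurableT_comp; first exact: measurable_indic.
exact: pp_loc_measurable.
Qed.

(** [S] relates a translation [t] to a point [u]. Integrating over [t] first yields the factor [c]
    at every point, whatever its position. *)
Lemma tonelli_points f (S : set (plane R * plane R)) (c : R) (D : set (plane R)) :
  mark_ge0 f -> measurable_mark f -> measurable S -> measurable D ->
  (forall u, @area R [set t | S (t, u)] = c%:E) ->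
  \int[@area R]_t \int[P]_w
    (\esum_(u in points X w `&` [set u | S (t, u) /\ D u]) f w u)
  = c%:E * \int[P]_w \esum_(u in points X w `&` D) f w u.
Proof.
move=> f0 mf mS mD Sc.
(* The indicators of [D] and [S] stay separate factors, as only the latter depends on [t]. *)
pose F (t : plane R) w n :=
  mark f n w * (\1_D (pp_loc X n w))%:E * (\1_S (t, pp_loc X n w))%:E.
have F0 t w n : 0 <= F t w n by rewrite !mule_ge0 ?mark_ge0P ?lee_fin.
have mloc n : measurable_fun setT (pp_loc X n) by exact: pp_loc_measurable.
have mF n : measurable_fun setT (fun x : plane R * Omega => F x.1 x.2 n).
  have msnd : measurable_fun setT (fun x : plane R * Omega => pp_loc X n x.2).
    by apply: measurableT_comp => //; exact: measurable_snd.
  apply: emeasurable_funM; first apply: emeasurable_funM.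
  - apply: measurableT_comp; first exact: measurable_markT.
    exact: measurable_snd.
  - apply/measurable_EFinP; apply: measurableT_comp => //.
  - apply/measurable_EFinP; apply: measurableT_comp => //.
    by apply: measurable_fun_pair => //; exact: measurable_fst.
transitivity (\int[@area R]_t \int[P]_w \sum_(n <oo) F t w n).
  apply: eq_integral => t _; apply: eq_integral => w _.
  rewrite esum_points//; apply: eq_eseriesr => n _; rewrite /F -muleA -EFinM.
  congr (_ * (_)%:E); rewrite !indicE.
  have [Du|Du] := pselect (D (pp_loc X n w)); last first.
    by rewrite (memNset Du) mul0r memNset// => -[_].
  rewrite (mem_set Du) mul1r; have [Su|Su] := pselect (S (t, pp_loc X n w)).
    by rewrite !mem_set.
  by rewrite (memNset Su) memNset// => -[].
pose G (x : plane R * Omega) := \sum_(n <oo) F x.1 x.2 n.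
have mG : measurable_fun setT G.
  by apply: ge0_emeasurable_sum => // n x _ _; exact: F0.
transitivity (\int[P]_w \int[@area R]_t G (t, w)).
  have G0 x : 0 <= G x by apply: nneseries_ge0.
  exact: (@fubini_tonelli _ _ _ _ _ _ _ G mG G0).
have c0 : 0 <= c%:E by rewrite -(Sc 0%R); exact: measure_ge0.
rewrite -ge0_integralZl//; last 2 first.
- exact: measurable_esum_points.
- by move=> w _; apply: esum_ge0 => u [+ _]; exact: f0.
apply: eq_integral => w _; rewrite /G/= integral_nneseries//; last first.
  by move=> n; exact: (measurable_fun_pair1 _ (mF n)).
rewrite esum_points// -nneseriesZl; last first.
  by move=> n _; rewrite mule_ge0 ?mark_ge0P ?lee_fin.
apply: eq_eseriesr => n _; rewrite /F ge0_integralZl//.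
- have mSn : measurable [set t | S (t, pp_loc X n w)].
    have := measurable_ysection (pp_loc X n w) mS.
    by congr measurable; apply/seteqP; split => t; rewrite /ysection/= inE.
  have -> : (fun t => (\1_S (t, pp_loc X n w))%:E) =
      (fun t => (\1_[set t | S (t, pp_loc X n w)] t)%:E :> \bar R).
    by apply/funext => t; rewrite !indicE; congr (_%:R%:E); apply: asbool_equiv_eq.
  by rewrite integral_indic// setIT muleC; congr (_ * _); exact: Sc.
- apply/measurable_EFinP; apply: measurableT_comp; first exact: measurable_indic.
  apply: measurable_fun_pair; first exact: measurable_id.
  exact: measurable_cst.
- by rewrite mule_ge0 ?mark_ge0P ?lee_fin.
Qed.

(** * Campbell's formula for marks covariant under a measure-preserving flow *)

Section Campbell.
Variable theta : plane R -> Omega -> Omega.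
Hypothesis measurable_theta : forall t, measurable_fun [set: Omega] (theta t).
Hypothesis theta_preserving : forall t A, measurable A -> P (theta t @^-1` A) = P A.
Hypothesis points_theta : forall t w u, points X (theta t w) (u - t)%R <-> points X w u.

Definition covariant f :=
  forall t w u, points X w u -> f (theta t w) (u - t)%R = f w u.

(** The points of [theta t w] are those of [w] translated by [- t], so the sum is reindexed along
    the injection [u - t]. *)
Lemma esum_points_theta f B t w : covariant f ->
  \esum_(u in points X (theta t w) `&` B) f (theta t w) u
  = \esum_(u in points X w `&` [set u | B (u - t)%R]) f w u.
Proof.
move=> fE.
have -> : points X (theta t w) `&` B =
    (fun u => u - t)%R @` (points X w `&` [set u | B (u - t)%R]).
  apply/seteqP; split => [u [Xu Bu]|_ [u [Xu Bu] <-]]; last first.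
    by split => //; exact/points_theta.
  exists (u + t)%R; last by rewrite addrK.
  by split; rewrite /= ?addrK//; apply/(points_theta t); rewrite addrK.
rewrite esum_image; last by move=> u v _ _; exact: addIr.
by apply: eq_esum => u [Xu _]; exact: fE.
Qed.

Lemma integral_theta t (h : Omega -> \bar R) : measurable_fun setT h ->
  (forall w, 0 <= h w) -> \int[P]_w h (theta t w) = \int[P]_w h w.
Proof.
move=> mh h0.
rewrite -[LHS](@ge0_integral_pushforward _ _ _ _ _ _ (measurable_theta t) _ setT)//.
by apply: eq_measure_integral => A mA _; exact: theta_preserving.
Qed.

(* With C the unit square, [1_B(u)] is the integral over t of
   [1_B(u) 1_C(u - t)], and [area B] that of [1_B(u + t)]. By Tonelli, both
   sides become integrals over t of mean sums over the points, and for each t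
   these mean sums agree because theta t preserves P. *)
Lemma campbell f B : mark_ge0 f -> measurable_mark f -> covariant f ->
  measurable B -> area B < +oo ->
  \int[P]_w (\esum_(u in points X w `&` B) f w u)
  = area B * \int[P]_w (\esum_(u in points X w `&` @unit_square R) f w u).
Proof.
move=> f0 mf fE mB Bfin.
have mC := @measurable_unit_square R.
have finB : area B \is a fin_num by rewrite ge0_fin_numE// measure_ge0.
have mpre (g : plane R * plane R -> plane R) D : measurable_fun setT g ->
    measurable D -> measurable (g @^-1` D).
  by move=> mg mD; rewrite -[X in measurable X]setTI; exact: mg.
have mS1 : measurable [set x : plane R * plane R | unit_square (x.2 - x.1)%R].
  apply: mpre => //; apply: measurable_planeB; first exact: measurable_snd.
  exact: measurable_fst.
have mS2 : measurable [set x : plane R * plane R | B (x.2 + x.1)%R].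
  apply: mpre => //; apply: measurable_planeD; first exact: measurable_snd.
  exact: measurable_fst.
have S1E u : area [set t | unit_square (u - t)%R] = 1%:E :> \bar R.
  by rewrite area_preimageB// area_unit_square.
have S2E u : area [set t | B (u + t)%R] = (fine (area B))%:E.
  by rewrite area_preimageD// fineK.
rewrite -[LHS]mul1e -(fineK finB).
apply: (etrans (esym (tonelli_points f0 mf mS1 mB S1E))).
apply: (etrans _ (tonelli_points f0 mf mS2 mC S2E)).
apply: eq_integral => t _ /=.
have mBt : measurable [set u | B (u + t)%R /\ @unit_square R u].
  have mDt : measurable_fun [set: plane R] (fun u => u + t : plane R)%R.
    by apply: measurable_planeD; [exact: measurable_id|exact: measurable_cst].
  by apply: measurableI => //; rewrite -[X in measurable X]setTI; exact: mDt.
(* Only the right-hand integrand is composed with [theta t]: reindexing its points by [u - t] turns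
   the conditions [B (u + t)] and [C u] into [B u] and [C (u - t)], those of the left-hand side. *)
rewrite -[RHS](@integral_theta t); last 2 first.
- exact: measurable_esum_points.
- by move=> w; apply: esum_ge0 => u [+ _]; exact: f0.
apply: eq_integral => w _; rewrite esum_points_theta//.
by congr (\esum_(u in _ `&` _) _); apply/seteqP; split => u /=; rewrite subrK => -[].
Qed.

End Campbell.

End MarkedPointProcess.

(** Pointwise, the sum of [f] is at most [+oo] times the sum of [g]: if the latter is 0, all its
    terms vanish and so do those of [f]; otherwise the bound is [+oo]. The integral of the bound is
    [+oo * 0 = 0]. *)
Lemma le_integral_points_eq0 {R : realType} {d : measure_display}
    {Omega : measurableType d} (P : probability Omega R) (X : pointProcess R Omega)
    (f g : Omega -> plane R -> \bar R) (B : set (plane R)) : measurable B ->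
  mark_ge0 X f -> measurable_mark X f -> mark_ge0 X g -> measurable_mark X g ->
  (forall w u, points X w u -> g w u = 0 -> f w u = 0)%E ->
  (\int[P]_w (\esum_(u in points X w `&` B) g w u) = 0)%E ->
  (\int[P]_w (\esum_(u in points X w `&` B) f w u) = 0)%E.
Proof.
move=> mB f0 mf g0 mg gf g_eq0.
have sum_ge0 h : mark_ge0 X h ->
    forall w, (0 <= \esum_(u in points X w `&` B) h w u)%E.
  by move=> h0 w; apply: esum_ge0 => u [+ _]; exact: h0.
apply/eqP; rewrite eq_le integral_ge0 ?andbT; last by move=> w _; exact: sum_ge0.
have <- : (+oo * \int[P]_w (\esum_(u in points X w `&` B) g w u) = 0)%E.
  by rewrite g_eq0 mule0.
rewrite -ge0_integralZl//; last 2 first.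
- exact: measurable_esum_points.
- by move=> w _; exact: sum_ge0.
apply: ge0_le_integral => //.
- by move=> w _; exact: sum_ge0.
- exact: measurable_esum_points.
- by apply: measurable_funeM; exact: measurable_esum_points.
move=> w _; have := sum_ge0 _ g0 w; rewrite le_eqVlt => /orP[/eqP gw0|gw_gt0].
  rewrite esum1 ?mule_ge0 ?sum_ge0// => u [Xu Bu]; apply: gf => //.
  apply/eqP; rewrite eq_le g0// andbT gw0.
  apply: esum_ge; exists [set u]; last by rewrite fsbig_set1.
  by split; [exact: finite_set1|move=> _ ->].
by rewrite gt0_mulye// leey.
Qed.

(** Lets the intensity hypothesis be read as a mean sum of the constant mark 1. *)
Lemma count_esum {R : realType} {d : measure_display} {Omega : measurableType d}
    (X : pointProcess R Omega) (B : set (plane R)) (w : Omega) :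
  Defs.count X B w = (\esum_(u in points X w `&` B) 1%E)%E.
Proof.
rewrite /Defs.count /counting; set A := points X w `&` B.
transitivity (\esum_(u in A) \d_ u A : \bar R)%E; last first.
  by apply: eq_esum => u Au; rewrite diracE mem_set.
by case: ifPn => /asboolP finA;
  [exact: esym (finite_card_dirac R finA)|exact: esym (infinite_card_dirac R finA)].
Qed.

(** * Measurability of powers, interference, SINR and rates *)

Section Network.
Context {R : realType} {d : measure_display} {Omega : measurableType d}.
Variables (P : probability Omega R) (k : nat) (Q : cellParams R k) (md : mode).
Variable N : @network R d Omega k.
Hypothesis hN : is_network Q P N md.
Implicit Types (f g : Omega -> plane R -> \bar R).
Local Notation X := (UE N).
Local Notation loc n w := (pp_loc (UE N) n w).
Local Notation base i m w := (pp_loc (BS N i) m w).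

Definition served n i m : set Omega := [set w |
  [/\ pp_on (UE N) n w, pp_on (BS N i) m w &
      serving N w (loc n w) = (i, base i m w)]].

Lemma measurable_served n i m : measurable (served n i m).
Proof. exact: (serving_measurable hN). Qed.
Local Hint Resolve measurable_served : core.

Lemma pp_on_points n w : pp_on X n w -> points X w (loc n w).
Proof. by exists n. Qed.

(** Every UE has a serving station, which is an enumerated point of some tier. The union is indexed
    by codes of pairs (tier, index), and numbers that code nothing contribute the empty set. *)
Lemma pp_on_served n :
  pp_on X n = \bigcup_p (if unpickle p is Some im then served n im.1 im.2 else set0).
Proof.
apply/seteqP; split => w; last by case=> p _; case: unpickle => //= im [].
move=> on_n; case: (serving_station hN (pp_on_points on_n)) => m on_m eq_m.
exists (pickle ((serving N w (loc n w)).1, m)) => //.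
by rewrite pickleK /=; split => //; rewrite -eq_m -surjective_pairing.
Qed.

(* Neither [serving] nor [gain] is assumed measurable; on each piece
   [served n i m] they reduce to [pp_loc] and [gain_rv], which are. *)
Lemma measurable_fun_served d' (T : measurableType d') (g : Omega -> T) n :
  (forall i m, measurable_fun (served n i m) g) -> measurable_fun (pp_on X n) g.
Proof.
move=> mg; rewrite pp_on_served; apply/measurable_fun_bigcup => p.
  by case: unpickle.
by case: unpickle => [[i m]|]; [exact: mg|exact: measurable_fun_set0].
Qed.

Lemma tier_served n i m w : served n i m w -> tier N w (loc n w) = i.
Proof. by case=> _ _; rewrite /tier => ->. Qed.

Lemma rho_served n i m w : served n i m w ->
  rho N w (loc n w) = eudist (loc n w) (base i m w).
Proof. by case=> _ _; rewrite /rho => ->. Qed.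

Lemma measurable_powR_eudist n i m (a : R) :
  measurable_fun setT (fun w => eudist (loc n w) (base i m w) `^ a).
Proof.
apply: (@measurableT_comp _ _ _ _ _ _ (@powR R ^~ a)); first exact: measurable_powR.
by apply: measurable_eudist; exact: pp_loc_measurable.
Qed.

Lemma measurable_txpower n :
  measurable_fun (pp_on X n) (fun w => txpower Q N w (loc n w)).
Proof.
apply: measurable_fun_served => i m.
apply: (eq_measurable_fun
    (fun w => PU Q i * eudist (loc n w) (base i m w) `^ (alpha Q i * eps Q i))).
  move=> w /set_mem snim.
  by rewrite /txpower (tier_served snim) (rho_served snim).
by apply: measurable_funTS; apply: measurable_funM => //; exact: measurable_powR_eudist.
Qed.

Lemma txpower_ge0 w u : 0 <= txpower Q N w u.
Proof. by rewrite mulr_ge0 ?powR_ge0 ?ltW ?PU_gt0. Qed.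

Lemma interference_ge0 w u : (0 <= interference Q N w u)%E.
Proof.
apply: esum_ge0 => v _.
rewrite lee_fin; apply: mulr_ge0; last exact: powR_ge0.
by apply: mulr_ge0; [exact: txpower_ge0|exact: gain_ge0 hN _ _ _ _].
Qed.

Definition interfering n n' : set Omega := [set w |
  [/\ pp_on (UE N) n w, pp_on (UE N) n' w &
      interferers N w (loc n w) (loc n' w)]].

Lemma measurable_interfering n n' : measurable (interfering n n').
Proof. exact: (interferers_measurable hN). Qed.

(** Meant for realizations in [served n i m]: the serving station is replaced by the [m]-th BS of
    tier [i], and the gain by the measurable [gain_rv]. *)
Definition interference_term n i m n' : Omega -> \bar R :=
  (fun w => (txpower Q N w (loc n' w) * gain_rv N uplink n' i m w
    * eudist (loc n' w) (base i m w) `^ (- alpha Q (tier N w (loc n' w))))%:E)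
  \_ (interfering n n').

(** The law of [gain_rv] makes it nonnegative only almost surely; it is surely so where it equals
    [gain], that is where both the UE and the BS exist. *)
Lemma interference_term_ge0 n i m n' w : served n i m w ->
  (0 <= interference_term n i m n' w)%E.
Proof.
case=> on_n on_m _; rewrite /interference_term patchE.
case: ifPn => // /set_mem[_ on_n' _].
rewrite lee_fin; apply: mulr_ge0; last exact: powR_ge0.
apply: mulr_ge0; first exact: txpower_ge0.
by rewrite -(gain_rvE hN)//; exact: gain_ge0 hN _ _ _ _.
Qed.

Lemma interference_served n i m w : served n i m w ->
  interference Q N w (loc n w) = (\sum_(n' <oo) interference_term n i m n' w)%E.
Proof.
move=> snim; have [on_n on_m servingE] := snim; rewrite /interference servingE/=.
have -> : interferers N w (loc n w) = pp_loc X ^~ w @` [set n' | interfering n n' w].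
  apply/seteqP; split => [v Iv|_ [n' [_ on_n' ?] <-]//].
  have [[n' on_n' vE] _] := interferers_UE hN (pp_on_points on_n) Iv.
  by exists n' => //; split=> //; rewrite -vE.
rewrite esum_image; last first.
  by move=> p q /set_mem/= [_ on_p _] /set_mem/= [_ on_q _]; exact: pp_simple.
rewrite nneseries_esumT; last by move=> n'; exact: interference_term_ge0.
rewrite esum_mkcond; apply: eq_esum => n' _.
rewrite /interference_term patchE.
have [D|nD] := pselect (interfering n n' w); last by rewrite !memNset.
rewrite !mem_set//; congr (_ * _ * _)%:E.
by rewrite (gain_rvE hN)//; case: D.
Qed.

Lemma measurable_interference n :
  measurable_fun (pp_on X n) (fun w => interference Q N w (loc n w)).
Proof.
apply: measurable_fun_served => i m.
apply: (eq_measurable_fun (fun w => (\sum_(n' <oo) interference_term n i m n' w)%E)).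
  by move=> w /set_mem snim; rewrite (interference_served snim).
apply: ge0_emeasurable_sum => [n' w snim _|n' _].
  exact: interference_term_ge0.
apply: measurable_funTS; apply/measurable_restrict => //.
  exact: measurable_interfering.
rewrite setTI; apply: (@measurable_funS _ _ _ _ (pp_on X n')).
- exact: pp_on_measurable.
- by move=> w [].
apply/measurable_EFinP; apply: measurable_funM; first apply: measurable_funM.
- exact: measurable_txpower.
- exact: measurable_funTS (gain_rv_measurable hN _ _ _ _).
(* The exponent depends on the tier of the interferer; a second splitting, by the station serving
   [n'], makes it constant. *)
apply: measurable_fun_served => j l.
apply: (eq_measurable_fun
    (fun w => eudist (loc n' w) (base i m w) `^ (- alpha Q j))).
  by move=> w /set_mem sn'; rewrite (tier_served sn').
exact: measurable_funTS (measurable_powR_eudist _ _ _ _).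
Qed.

Lemma SINR_ge0 w u : 0 <= SINR Q N w u.
Proof.
apply: mulr_ge0.
  apply: mulr_ge0; last exact: powR_ge0.
  by apply: mulr_ge0; [exact/ltW/PU_gt0|exact: gain_ge0 hN _ _ _ _].
rewrite invr_ge0 fine_ge0// adde_ge0 ?interference_ge0// lee_fin ltW//.
exact: sigma2_gt0.
Qed.

Lemma measurable_SINR n :
  measurable_fun (pp_on X n) (fun w => SINR Q N w (loc n w)).
Proof.
have mI : measurable_fun (pp_on X n)
    (fun w => (fine (interference Q N w (loc n w) + (sigma2 Q)%:E)%E)^-1).
  (* The inverse is a power with exponent -1, since its argument is nonnegative. *)
  apply: (eq_measurable_fun
    (fun w => fine (interference Q N w (loc n w) + (sigma2 Q)%:E)%E `^ (-1))).
    move=> w _; rewrite powR_inv1// fine_ge0// adde_ge0 ?interference_ge0//.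
    by rewrite lee_fin ltW// sigma2_gt0.
  apply: (@measurableT_comp _ _ _ _ _ _ (@powR R ^~ (-1))); first exact: measurable_powR.
  apply: (@measurableT_comp _ _ _ _ _ _ (@fine R)) => //.
  by apply: emeasurable_funD => //; exact: measurable_interference.
apply: measurable_funM => //.
apply: measurable_fun_served => i m.
apply: (eq_measurable_fun (fun w => PU Q i * gain_rv N uplink n i m w
    * eudist (loc n w) (base i m w) `^ (alpha Q i * (eps Q i - 1)))).
  move=> w /set_mem snim; have [on_n on_m servingE] := snim.
  by rewrite (tier_served snim) (rho_served snim) servingE (gain_rvE hN).
apply: measurable_funTS; apply: measurable_funM; last exact: measurable_powR_eudist.
by apply: measurable_funM => //; exact: (gain_rv_measurable hN).
Qed.

Lemma assoc_prob_ge0 i : 0 <= assoc_prob Q P N i.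
Proof.
apply: fine_ge0; apply: mule_ge0; last by rewrite inve_ge0 lee_fin ltW ?lamU_gt0.
by apply: integral_ge0 => w _; apply: esum_ge0 => u _; case: ifP.
Qed.

Lemma rate_ge0 w u : 0 <= rate Q P N w u.
Proof.
apply: mulr_ge0; last by rewrite ln_ge0// lerDl SINR_ge0.
apply: divr_ge0; first exact/ltW/W_gt0.
apply: divr_ge0; last exact/ltW/lamB_gt0.
by apply: mulr_ge0; [exact: assoc_prob_ge0|exact/ltW/lamU_gt0].
Qed.

Lemma measurable_rate n :
  measurable_fun (pp_on X n) (fun w => rate Q P N w (loc n w)).
Proof.
apply: measurable_funM; last first.
  apply: (@measurableT_comp _ _ _ _ _ _ (@ln R)); first exact: measurable_ln.
  by apply: measurable_funD => //; exact: measurable_SINR.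
apply: measurable_fun_served => i m.
apply: (eq_measurable_fun (cst (W Q / nUE Q P N i))) => // w /set_mem snim.
by rewrite /= (tier_served snim).
Qed.

(** * Covariance of the network quantities under the flow *)

Lemma serving_shift_fst t w u : points X w u ->
  (serving N (Defs.shift N t w) (u - t)).1 = (serving N w u).1.
Proof. by move=> Xu; have -> := serving_shift hN t Xu. Qed.

Lemma serving_shift_snd t w u : points X w u ->
  (serving N (Defs.shift N t w) (u - t)).2 = (serving N w u).2 - t.
Proof. by move=> Xu; have -> := serving_shift hN t Xu. Qed.

Lemma tier_shift t w u : points X w u -> tier N (Defs.shift N t w) (u - t) = tier N w u.
Proof. exact: serving_shift_fst. Qed.

Lemma rho_shift t w u : points X w u -> rho N (Defs.shift N t w) (u - t) = rho N w u.
Proof. by move=> Xu; rewrite /rho (serving_shift_snd t Xu) eudistB. Qed.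

Lemma txpower_shift t w u : points X w u ->
  txpower Q N (Defs.shift N t w) (u - t) = txpower Q N w u.
Proof. by move=> Xu; rewrite /txpower (tier_shift t Xu) (rho_shift t Xu). Qed.

Lemma gain_serving_shift l t w u v : points X w u -> points X w v ->
  gain N l (Defs.shift N t w) (v - t) (serving N (Defs.shift N t w) (u - t))
  = gain N l w v (serving N w u).
Proof.
move=> Xu Xv; rewrite (serving_shift hN t Xu).
exact: (gain_shift hN l t Xv (serving_station hN Xu)).
Qed.

(** The set of interferers is translated as a whole. Interferers are UE themselves, so their powers,
    tiers and gains are covariant too, and distances are translation invariant. *)
Lemma interference_shift t w u : points X w u ->
  interference Q N (Defs.shift N t w) (u - t) = interference Q N w u.
Proof.
move=> Xu; rewrite /interference.
have -> : interferers N (Defs.shift N t w) (u - t) =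
    (fun v => v - t) @` interferers N w u.
  apply/seteqP; split => [v Iv|_ [v Iv <-]].
    exists (v + t); last by rewrite addrK.
    by apply/(interferers_shift hN t _ Xu); rewrite addrK.
  exact/(interferers_shift hN t _ Xu).
rewrite esum_image; last by move=> v v' _ _; exact: addIr.
apply: eq_esum => v /(interferers_UE hN Xu)[Xv _].
by rewrite (txpower_shift t Xv) (tier_shift t Xv) (gain_serving_shift _ t Xu Xv)
  (serving_shift_snd t Xu) eudistB.
Qed.

Lemma SINR_shift t w u : points X w u -> SINR Q N (Defs.shift N t w) (u - t) = SINR Q N w u.
Proof.
move=> Xu; rewrite /SINR (tier_shift t Xu) (rho_shift t Xu) (interference_shift t Xu).
by rewrite (gain_serving_shift _ t Xu Xu).
Qed.

Lemma rate_shift t w u : points X w u ->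
  rate Q P N (Defs.shift N t w) (u - t) = rate Q P N w u.
Proof. by move=> Xu; rewrite /rate (tier_shift t Xu) (SINR_shift t Xu). Qed.

(** * Mean sums over windows and Palm expectations *)

Local Open Scope ereal_scope.

Definition on_tier (i : 'I_k) f w u : \bar R := if tier N w u == i then f w u else 0.

Definition window_sum f (B : set (plane R)) : \bar R :=
  \int[P]_w (\esum_(u in points X w `&` B) f w u).

Record stationary_mark f : Prop := StationaryMark {
  stationary_mark_ge0 : mark_ge0 X f;
  stationary_mark_measurable : measurable_mark X f;
  stationary_mark_covariant : covariant X (Defs.shift N) f }.

Lemma stationary_on_tier i f : stationary_mark f -> stationary_mark (on_tier i f).
Proof.
case=> f0 mf fE; split.
- by move=> w u Xu; rewrite /on_tier; case: ifP => // _; exact: f0.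
- move=> n; apply: measurable_fun_served => j m.
  have [ji|ji] := eqVneq j i; last first.
    apply: (eq_measurable_fun (cst 0)) => // w /set_mem snjm.
    by rewrite /on_tier (tier_served snjm) (negbTE ji).
  apply: (eq_measurable_fun (fun w => f w (loc n w))) => [w /set_mem snjm|].
    by rewrite /on_tier (tier_served snjm) ji eqxx.
  apply: measurable_funS (mf n); first exact: pp_on_measurable.
  by move=> w [].
by move=> t w u Xu; rewrite /on_tier (tier_shift t Xu) fE.
Qed.

Lemma stationary_rate : stationary_mark (fun w u => (rate Q P N w u)%:E).
Proof.
split.
- by move=> w u _; rewrite lee_fin rate_ge0.
- by move=> n; apply/measurable_EFinP; exact: measurable_rate.
by move=> t w u Xu; rewrite (rate_shift t Xu).
Qed.

Lemma stationary_txpower : stationary_mark (fun w u => (txpower Q N w u)%:E).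
Proof.
split.
- by move=> w u _; rewrite lee_fin txpower_ge0.
- by move=> n; apply/measurable_EFinP; exact: measurable_txpower.
by move=> t w u Xu; rewrite (txpower_shift t Xu).
Qed.

Lemma stationary_cst1 : stationary_mark (fun _ _ => 1).
Proof. by split => // n; exact: measurable_cst. Qed.

Lemma window_sum_ge0 f B : stationary_mark f -> 0 <= window_sum f B.
Proof.
case=> f0 _ _; apply: integral_ge0 => w _.
by apply: esum_ge0 => u [+ _]; exact: f0.
Qed.

Lemma window_sum_area f B : stationary_mark f -> measurable B -> area B < +oo ->
  window_sum f B = area B * window_sum f unit_square.
Proof.
case=> f0 mf fE mB Bfin; apply: (@campbell _ _ _ _ _ (Defs.shift N)) => //.
- exact: shift_measurable hN.
- exact: shift_preserving hN.
- by move=> t w u; exact: UE_shift hN _ _ _.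
Qed.

(** Each UE has exactly one tier, so at each UE only one summand can be nonzero; nonnegativity
    allows the finite sum to be exchanged with the sum over points and the integral. *)
Lemma window_sum_tiers f B : stationary_mark f -> measurable B ->
  window_sum f B = \sum_(i < k) window_sum (on_tier i f) B.
Proof.
move=> sf mB; have sfi i := stationary_on_tier i sf.
rewrite /window_sum -ge0_integral_sum//; last 2 first.
- by move=> i; case: (sfi i) => f0 mf _; exact: measurable_esum_points.
- by move=> i w _; apply: esum_ge0 => u [+ _]; case: (sfi i) => + _ _; exact.
apply: eq_integral => w _; rewrite -esum_sum; last first.
  by move=> u i [Xu _] _; case: (sfi i) => + _ _; exact.
apply: eq_esum => u _; rewrite (bigD1 (tier N w u))//= big1 => [|i].
  by rewrite adde0 /on_tier eqxx.
by rewrite /on_tier eq_sym => /negbTE ->.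
Qed.

Lemma window_sum_on_tier i f B :
  \int[P]_w (\esum_(u in points X w `&` B `&` [set u | tier N w u = i]) f w u)
  = window_sum (on_tier i f) B.
Proof.
apply: eq_integral => w _; rewrite esum_mkcondr; apply: eq_esum => u _.
rewrite /on_tier; have [ui|ui] := eqVneq (tier N w u) i.
  by rewrite mem_set.
by rewrite memNset//; exact/eqP.
Qed.

(** By covariance, the mark at the origin of the realization seen from [u] is the mark at [u]. *)
Lemma palmE_window_sum f : stationary_mark f ->
  palmE Q P N (fun w => f w 0%R) = window_sum f unit_square / (lamU Q)%:E.
Proof.
case=> _ _ fE; congr (_ / _); apply: eq_integral => w _.
by apply: eq_esum => u [Xu _]; rewrite -[in LHS](subrr u) fE.
Qed.

(** Since [assoc_prob] is defined through [fine], finiteness must be shown: the sum is at most the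
    number of UE in the unit square, whose mean is [lamU Q]. *)
Lemma assoc_probE i :
  (assoc_prob Q P N i * lamU Q)%:E = window_sum (on_tier i (fun _ _ => 1)) unit_square.
Proof.
have s1 := stationary_on_tier i stationary_cst1.
have finS : window_sum (on_tier i (fun _ _ => 1)) unit_square \is a fin_num.
  rewrite ge0_fin_numE ?window_sum_ge0//.
  apply: (@le_lt_trans _ _ (lamU Q)%:E); last exact: ltry.
  have := UE_intensity hN (@measurable_unit_square R).
  rewrite area_unit_square mule1 => <-.
  have [s0 ms _] := s1; have mC := @measurable_unit_square R.
  apply: ge0_le_integral => //.
  - by move=> w _; apply: esum_ge0 => u [+ _]; exact: s0.
  - exact: measurable_esum_points.
  - rewrite (funext (count_esum X unit_square)).
    by case: stationary_cst1 => c0 mc _; exact: measurable_esum_points.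
  move=> w _; rewrite count_esum; apply: le_esum => u _.
  by rewrite /on_tier; case: ifP => // _; rewrite lee01.
have lamU_neq0 : lamU Q != 0%R by rewrite gt_eqF ?lamU_gt0.
rewrite /assoc_prob (palmE_window_sum s1) -(fineK finS) inver (negbTE lamU_neq0).
by rewrite -EFinM/= divfK.
Qed.

(** The mean number of tier-[i] UE in the square is then 0, which forces the mean sum of any mark
    over them to vanish, even an unbounded one. *)
Lemma window_sum_eq0 i f : stationary_mark f -> assoc_prob Q P N i = 0%R ->
  window_sum (on_tier i f) unit_square = 0.
Proof.
move=> sf A0; have [f0 mf _] := stationary_on_tier i sf.
have [s0 ms _] := stationary_on_tier i stationary_cst1.
apply: (le_integral_points_eq0 (@measurable_unit_square R) f0 mf s0 ms).
  by move=> w u _; rewrite /on_tier; case: ifP => // _ /eqP; rewrite onee_eq0.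
by have := assoc_probE i; rewrite A0 mul0r => /esym.
Qed.

Section TierExpectation.
Variables (i : 'I_k) (f : Omega -> plane R -> \bar R) (h : Omega -> R).
Hypothesis sf : stationary_mark f.
(** [Rbar] and [EP] use the constants of the fixed tier [i], while [rate] and [txpower] use those of
    the tier of the UE; the two must agree only for a typical UE of tier [i]. *)
Hypothesis hf : forall w, tier N w 0%R = i -> (h w)%:E = f w 0%R.

Lemma tierE_window_sum : tierE Q P N i h =
  window_sum (on_tier i f) unit_square / (lamU Q)%:E / (assoc_prob Q P N i)%:E.
Proof.
rewrite -(palmE_window_sum (stationary_on_tier i sf)) /tierE.
congr (palmE _ _ _ _ / _).
by apply/funext => w; rewrite /on_tier; case: eqP => // /hf.
Qed.

(* Dividing by a null association probability is harmless: the numerator is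
   then 0, and [0 / 0 = 0] in [\bar R]. *)
Lemma tierE_eq0 : assoc_prob Q P N i = 0%R -> tierE Q P N i h = 0.
Proof. by move=> A0; rewrite tierE_window_sum window_sum_eq0// !mul0e. Qed.

(** The factors of [NUE] cancel the conditioning on the tier and the Palm normalization; for a null
    association probability both sides are 0. *)
Lemma tierE_NUE :
  tierE Q P N i h * (NUE Q P N i)%:E = window_sum (on_tier i f) unit_square.
Proof.
have [A0|A0] := eqVneq (assoc_prob Q P N i) 0%R.
  by rewrite tierE_eq0// mul0e window_sum_eq0.
have lamU_neq0 : lamU Q != 0%R by rewrite gt_eqF ?lamU_gt0.
rewrite tierE_window_sum /NUE !inver (negbTE A0) (negbTE lamU_neq0).
by rewrite -!muleA -!EFinM mulKf// mulVf// mule1.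
Qed.

End TierExpectation.

End Network.

(** * Cancellation in extended quotients, and the energy efficiencies *)

Lemma divee_pmul2l {R : realType} (a x y : \bar R) : (0 < a)%E -> (a < +oo)%E ->
  (a * x / (a * y) = x / y)%E.
Proof.
case: a => // r; rewrite lte_fin => r0 _; have rn0 : r != 0 by rewrite gt_eqF.
rewrite inveM; last first.
  by rewrite /inveM_def; case: y => // s; rewrite (negbTE rn0) (ltW r0) implybT.
by rewrite muleACA inver (negbTE rn0) -EFinM mulfV// mul1e.
Qed.

Lemma divee_pmul2r {R : realType} (a : R) (x y : \bar R) : (0 < a)%R ->
  (x * a%:E / (y * a%:E) = x / y)%E.
Proof. by move=> a0; rewrite ![(_ * a%:E)%E]muleC divee_pmul2l ?lte_fin ?ltry. Qed.

Theorem corollary2 (R : realType) (d : measure_display) (Omega : measurableType d)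
    (P : probability Omega R) (k : nat) (hk : (0 < k)%N) (Q : cellParams R k)
    (md : mode) (N : network k) (hN : is_network Q P N md)
    (B : set (plane R)) (mB : measurable B) (B_gt0 : (0 < area B)%E)
    (B_fin : (area B < +oo)%E) :
  (forall i : 'I_k,
     EE_tier Q P N i B
       = (Rbar Q P N i * (NUE Q P N i)%:E / (EP Q P N i * (NUE Q P N i)%:E))%E /\
     (Rbar Q P N i * (NUE Q P N i)%:E / (EP Q P N i * (NUE Q P N i)%:E))%E
       = (Rbar Q P N i / EP Q P N i)%E) /\
  EE Q P N B
    = ((\sum_(i < k) Rbar Q P N i * (NUE Q P N i)%:E)
       / (\sum_(j < k) EP Q P N j * (NUE Q P N j)%:E))%E.
Proof.
have srate := stationary_rate hN; have spower := stationary_txpower hN.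
have ratei i w : tier N w 0 = i ->
    (W Q / nUE Q P N i * ln (1 + SINR Q N w 0))%:E = (rate Q P N w 0)%:E.
  by rewrite /rate => ->.
have poweri i w : tier N w 0 = i ->
    (PU Q i * rho N w 0 `^ (alpha Q i * eps Q i))%:E = (txpower Q N w 0)%:E.
  by rewrite /txpower => ->.
have RN i := tierE_NUE hN srate (ratei i).
have EN i := tierE_NUE hN spower (poweri i).
have sratei i := stationary_on_tier hN i srate.
have spoweri i := stationary_on_tier hN i spower.
split=> [i|].
  split.
    rewrite /EE_tier !(window_sum_on_tier P).
    rewrite (window_sum_area hN (sratei i) mB B_fin).
    rewrite (window_sum_area hN (spoweri i) mB B_fin).
    apply: (etrans (divee_pmul2l _ _ B_gt0 B_fin)).
    by congr (_ / _)%E; [exact/esym/RN|exact/esym/EN].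
  (* For a null association probability [Rbar] is 0, so both quotients are 0 whatever their
     denominators; otherwise [NUE] is positive and cancels. *)
  have [A0|A0] := eqVneq (assoc_prob Q P N i) 0.
    by rewrite /Rbar (tierE_eq0 hN srate (ratei i) A0) !mul0e.
  have NUE_gt0 : 0 < NUE Q P N i.
    by rewrite mulr_gt0 ?lamU_gt0// lt_neqAle eq_sym A0 assoc_prob_ge0.
  exact: divee_pmul2r.
(* The area is cancelled before the UE are split by tier, so each summand is already a mean sum over
   the unit square. *)
rewrite -[LHS]/(window_sum P N _ B / window_sum P N _ B)%E.
rewrite (window_sum_area hN srate mB B_fin) (window_sum_area hN spower mB B_fin).
apply: (etrans (divee_pmul2l _ _ B_gt0 B_fin)).
rewrite (window_sum_tiers hN srate (@measurable_unit_square R)).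
rewrite (window_sum_tiers hN spower (@measurable_unit_square R)).
by congr (_ / _)%E; apply: eq_bigr => i _; [exact/esym/RN|exact/esym/EN].
Qed.
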